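(* Let $(W,S)_B$ be a Lorentzian Coxeter system. Let $E_\infty\subset\mathbb{P}V$ be the set of directions $\widehat{\mathbf x}$ of non-unimodular eigenvectors $\mathbf x$ of infinite-order elements $w\in W$ (acting on $V$). Then the set of limit roots $E_\Phi$ of $(W,S)_B$ is the closure of $E_\infty$ in $\mathbb{P}V$: $$E_\Phi=\overline{E_\infty}.$$
   Context: Let $(W,S)$ be a Coxeter system with $S$ finite, $|S|=n$ (the rank), with relations $(st)^{m_{st}}=e$, $m_{ss}=1$, $m_{st}=m_{ts}\ge 2$ or $=\infty$ for $s\ne t$. Associate to it a symmetric matrix $B$ with $B_{st}=-\cos(\pi/m_{st})$ if $m_{st}<\infty$ and $B_{st}=-c_{st}$ if $m_{st}=\infty$, where the $c_{st}=c_{ts}\ge 1$ are arbitrarily chosen. The pair is a geometric Coxeter system, denoted $(W,S)_B$. Let $V$ be a real vector space with basis $\Delta=\{\alpha_s\}_{s\in S}$ (simple roots) and bilinear form $\mathcal B(\alpha_s,\alpha_t)=B_{st}$. $W$ acts faithfully on $V$, with $s\in S$ acting as the reflection $\mathbf x\mapsto \mathbf x-2\frac{\mathcal B(\mathbf x,\alpha_s)}{\mathcal B(\alpha_s,\alpha_s)}\alpha_s$; write $w(\mathbf x)$ for the action. The system is Lorentzian if $\mathcal B$ has signature $(n-1,1)$. $\mathbb{P}V$ is the projective space of $1$-dimensional subspaces of $V$ with its usual topology; for $\mathbf x\in V\setminus\{0\}$, $\widehat{\mathbf x}\in\mathbb{P}V$ is the line spanned by $\mathbf x$. The roots are $\Phi=W(\Delta)$.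 The set of limit roots $E_\Phi$ is the set of $\widehat{\mathbf x}\in\mathbb{P}V$ for which there is an injective sequence $(\gamma_i)_{i\in\mathbb N}$ in $\Phi$ with $\lim_{i\to\infty}\widehat{\gamma_i}=\widehat{\mathbf x}$. An eigenvalue $\lambda\in\mathbb C$ is unimodular if $|\lambda|=1$; an eigenvector is non-unimodular if its eigenvalue is not unimodular. (Non-unimodular eigenvalues of the transformations preserving a Lorentzian form are real, with real eigendirections.) *)

(* Defs.v *)
From HB Require Import structures.
From mathcomp Require Import all_boot all_order all_algebra.
From mathcomp Require Import all_classical all_reals all_analysis.
Set Implicit Arguments.
Unset Strict Implicit.
Unset Printing Implicit Defensive.
Import Order.TTheory GRing.Theory Num.Theory.
Import numFieldNormedType.Exports.
Local Open Scope classical_set_scope.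
Local Open Scope ring_scope.
Local Open Scope quotient_scope.

(** The generating set S of rank n is indexed by 'I_n.  In a Coxeter matrix m,
    [m i j = Some k] stands for m_ij = k and [m i j = None] for m_ij = oo. *)
Definition coxeter_matrix (n : nat) (m : 'I_n -> 'I_n -> option nat) : Prop :=
  [/\ forall i, m i i = Some 1%N,
      forall i j, m i j = m j i
    & forall i j k, i != j -> m i j = Some k -> (2 <= k)%N].

Definition coxeter_relations (n : nat) (m : 'I_n -> 'I_n -> option nat)
    (G : groupType) (f : 'I_n -> G) : Prop :=
  forall i j k, m i j = Some k -> ((f i * f j) ^+ k = 1)%g.

(** W is the group presented by the generators s_i and the Coxeter relations:
    the relations hold, the s_i generate W (as a monoid, since s_i^2 = 1), and
    every family satisfying the relations in a group G extends to a
    homomorphism W -> G. *)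
Definition coxeter_system (n : nat) (m : 'I_n -> 'I_n -> option nat)
    (W : groupType) (s : 'I_n -> W) : Prop :=
  [/\ coxeter_matrix m,
      coxeter_relations m s,
      forall w : W, exists u : seq 'I_n, w = (\prod_(i <- u) s i)%g
    & forall (G : groupType) (f : 'I_n -> G), coxeter_relations m f ->
        exists phi : W -> G, {morph phi : x y / (x * y)%g >-> (x * y)%g}
                             /\ forall i, phi (s i) = f i].

(** The weights c_ij are constrained, and used, only where m_ij = oo. *)
Definition coxeter_weights (R : realType) (n : nat)
    (m : 'I_n -> 'I_n -> option nat) (c : 'I_n -> 'I_n -> R) : Prop :=
  forall i j, m i j = None -> c i j = c j i /\ 1 <= c i j.

Definition coxeter_gram (R : realType) (n : nat)
    (m : 'I_n -> 'I_n -> option nat) (c : 'I_n -> 'I_n -> R) : 'M[R]_n :=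
  \matrix_(i, j) if m i j is Some k then - cos (pi / k%:R) else - c i j.

(** V = R^n, with the simple roots as its standard basis. *)
Definition bform (R : realType) (n : nat) (B : 'M[R]_n) (x y : 'rV[R]_n) : R :=
  (x *m B *m y^T) 0 0.

Definition simple_root (R : realType) (n : nat) (i : 'I_n) : 'rV[R]_n :=
  delta_mx 0 i.

Definition reflection (R : realType) (n : nat) (B : 'M[R]_n)
    (a x : 'rV[R]_n) : 'rV[R]_n :=
  x - (2 * (bform B x a / bform B a a)) *: a.

(** Signature (p, q) in the sense of Sylvester: in some basis (the rows of P)
    the form is diagonal with p entries 1, q entries -1 and the others 0. *)
Definition has_signature (R : realType) (n : nat) (B : 'M[R]_n) (p q : nat) :
    Prop :=
  (p + q <= n)%N /\
  exists2 P : 'M[R]_n, P \in unitmx &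
    P *m B *m P^T =
      diag_mx (\row_(i < n) if (i < p)%N then 1
                            else if (i < p + q)%N then -1 else 0).

Definition lorentzian (R : realType) (n : nat) (B : 'M[R]_n) : Prop :=
  has_signature B n.-1 1.

(** The action of W on V; it is determined by the action of the generators. *)
Definition geometric_action (R : realType) (n : nat) (B : 'M[R]_n)
    (W : groupType) (s : 'I_n -> W) (act : W -> 'rV[R]_n -> 'rV[R]_n) : Prop :=
  [/\ forall x, act 1%g x = x,
      forall v w x, act (v * w)%g x = act v (act w x)
    & forall i x, act (s i) x = reflection B (simple_root R i) x].

(** [nzvec R n] is V \ {0} with the subspace topology, and [projspace R n] its
    quotient topological space; two nonzero vectors are identified when they
    span the same line. *)
Definition nzvec (R : realType) (n : nat) : topologicalType :=
  set_type [set x : 'rV[R]_n | x != 0].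

Definition nzvec_val (R : realType) (n : nat) (x : nzvec R n) : 'rV[R]_n :=
  set_val x.

Definition same_line (R : realType) (n : nat) : rel (nzvec R n) :=
  fun x y => (nzvec_val x == nzvec_val y)%MS.

Lemma same_line_refl (R : realType) (n : nat) : reflexive (@same_line R n).
Proof. by move=> x; rewrite /same_line !submx_refl. Qed.

Lemma same_line_sym (R : realType) (n : nat) : symmetric (@same_line R n).
Proof. by move=> x y; rewrite /same_line andbC. Qed.

Lemma same_line_trans (R : realType) (n : nat) : transitive (@same_line R n).
Proof.
move=> y x z /andP[xy yx] /andP[yz zy]; apply/andP.
by split; [exact: submx_trans xy yz | exact: submx_trans zy yx].
Qed.

Canonical same_line_equiv (R : realType) (n : nat) :=
  EquivRel (@same_line R n) (@same_line_refl R n) (@same_line_sym R n)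
    (@same_line_trans R n).

Definition projspace (R : realType) (n : nat) : topologicalType :=
  quotient_topology {eq_quot @same_line R n}.

Definition line (R : realType) (n : nat) (x : nzvec R n) : projspace R n :=
  \pi_(quotient_topology {eq_quot @same_line R n}) x.

Definition coxeter_roots (R : realType) (n : nat) (W : groupType)
    (act : W -> 'rV[R]_n -> 'rV[R]_n) : set 'rV[R]_n :=
  [set x | exists w i, x = act w (simple_root R i)].

Definition limit_roots (R : realType) (n : nat) (W : groupType)
    (act : W -> 'rV[R]_n -> 'rV[R]_n) : set (projspace R n) :=
  [set p | exists gamma : nat -> nzvec R n,
     [/\ injective gamma,
         forall k, coxeter_roots act (nzvec_val (gamma k))
       & (fun k => line (gamma k)) @ \oo --> p]].

Definition infinite_order (W : groupType) (w : W) : Prop :=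
  forall k : nat, (0 < k)%N -> (w ^+ k)%g <> 1%g.

(** A vector of V that is an eigenvector of w for an eigenvalue in C has a
    real eigenvalue, so l ranges over R. *)
Definition nonunimodular_directions (R : realType) (n : nat) (W : groupType)
    (act : W -> 'rV[R]_n -> 'rV[R]_n) : set (projspace R n) :=
  [set p | exists (w : W) (x : nzvec R n) (l : R),
     [/\ infinite_order w,
         act w (nzvec_val x) = l *: nzvec_val x,
         `|l| <> 1
       & p = line x]].

(* Main.v *)
Require Import Defs.
From HB Require Import structures.
From mathcomp Require Import all_boot all_order all_algebra.
From mathcomp Require Import all_classical all_reals all_analysis.
From mathcomp Require Import ring lra.
Set Implicit Arguments.
Unset Strict Implicit.
Unset Printing Implicit Defensive.
Import Order.TTheory GRing.Theory Num.Theory.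
Import numFieldNormedType.Exports.
Local Open Scope classical_set_scope.
Local Open Scope ring_scope.

(** The input from Coxeter groups is the discreteness of the set of roots.  For w
    in W, the vector w alpha_i has coordinates of one sign, and they are
    nonnegative unless w s_i is shorter than w ([act_simple_root_ge0]).  Hence
    an element close to the identity is the identity, roots in a bounded region
    are separated ([roots_separated]), and an injective sequence of roots is
    unbounded ([injective_roots_unbounded]).

    Let x span a limit root.  Multiples a g of roots g come arbitrarily close
    to x, and a tends to 0 because the roots g leave every bounded set.  The
    form is nondegenerate, so some simple root alpha_i is not orthogonal to x.
    The plane of g and alpha_i then has signature (1, 1), and one of its two
    isotropic lines is spanned by a g + t alpha_i with |t| <= |a|, hence is
    close to x.  The product of the reflections in alpha_i and g preserves this
    line with eigenvalue (t / a)^2, which is not 1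
    ([product_of_reflections], [limit_roots_sub_closure]).

    Conversely let w x = l x with |l| > 1, replacing w by its inverse if
    necessary.  There is y with w y = l^-1 y; both vectors are isotropic, they
    are not orthogonal, and the form is positive definite on the vectors
    orthogonal to both ([orthogonal_timelike_coercive]), so w has bounded orbits
    there.  Applying powers of w to a simple root that is not orthogonal to y
    yields infinitely many roots whose directions converge to the line of x
    ([eigendirection_limit]).  As the set of limit roots is closed
    ([limit_roots_closed]), the two inclusions give the equality.

    Topological statements are reduced to norm estimates by [nbhs_lineP]: a
    neighbourhood of a line is a set that contains the lines of all vectors
    close to a chosen vector of it. *)

(** * Symmetric bilinear forms and reflections *)

Section Bform.
Context (R : realType) (n : nat) (B : 'M[R]_n).
Context (Bsym : B^T = B).
Implicit Types (x y z : 'rV[R]_n) (a : R).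

Lemma bformDl x y z : bform B (x + y) z = bform B x z + bform B y z.
Proof. by rewrite /bform !mulmxDl mxE. Qed.

Lemma bformZl a x y : bform B (a *: x) y = a * bform B x y.
Proof. by rewrite /bform -!scalemxAl mxE. Qed.

Lemma bformC x y : bform B x y = bform B y x.
Proof.
rewrite /bform.
suff -> : x *m B *m y^T = (y *m B *m x^T)^T by rewrite mxE.
by rewrite !trmx_mul trmxK Bsym mulmxA.
Qed.

Lemma bformNl x y : bform B (- x) y = - bform B x y.
Proof. by rewrite -scaleN1r bformZl mulN1r. Qed.

Lemma bformDr x y z : bform B z (x + y) = bform B z x + bform B z y.
Proof. by rewrite bformC bformDl !(bformC z). Qed.

Lemma bformZr a x y : bform B x (a *: y) = a * bform B x y.
Proof. by rewrite bformC bformZl bformC. Qed.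

Lemma bformNr x y : bform B y (- x) = - bform B y x.
Proof. by rewrite bformC bformNl bformC. Qed.

Definition bformE := (bformDl, bformDr, bformNl, bformNr, bformZl, bformZr).

Lemma bform_reflection g x y : bform B g g = 1 ->
  bform B (x - (2 * bform B x g) *: g) (y - (2 * bform B y g) *: g) = bform B x y.
Proof. by move=> g1; rewrite !bformE g1 (bformC g y); ring. Qed.

Lemma bform_simple i j : bform B (simple_root R i) (simple_root R j) = B i j.
Proof. by rewrite /bform /simple_root trmx_delta -rowE -colE !mxE. Qed.

Lemma bform_nondeg x : B \in unitmx -> x != 0 ->
  exists i, bform B (simple_root R i) x != 0.
Proof.
move=> Bu x0; apply/existsP; apply: contraNT x0; rewrite negb_exists => /forallP h.
suff: B *m x^T = 0.
  by move=> /(congr1 (mulmx (invmx B))); rewrite mulKmx// mulmx0 => /(congr1 trmx);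
     rewrite trmxK trmx0 => ->.
apply/matrixP => i j; rewrite [RHS]mxE ord1; move: (h i); rewrite negbK => /eqP.
by rewrite /bform /simple_root -mulmxA -rowE mxE.
Qed.

End Bform.

(** * The dihedral coefficients *)

(** The coefficients met when the two reflections of a dihedral subgroup are
    applied alternately to a simple root: Chebyshev polynomials of the second
    kind, shifted so that index k has degree k - 1.  The shift makes the
    vector of step k have coordinates cheb (k + 1) and cheb k. *)
Fixpoint cheb (R : realType) (b : R) (k : nat) : R :=
  match k with
  | 0 => 0
  | k'.+1 => match k' with 0 => 1 | k''.+1 => 2 * b * cheb b k' - cheb b k'' end
  end.

Lemma chebSS (R : realType) (b : R) k :
  cheb b k.+2 = 2 * b * cheb b k.+1 - cheb b k.
Proof. by []. Qed.

Lemma cheb_sin (R : realType) (t : R) k : cheb (cos t) k * sin t = sin (k%:R * t).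
Proof.
suff: cheb (cos t) k * sin t = sin (k%:R * t) /\
      cheb (cos t) k.+1 * sin t = sin (k.+1%:R * t) by case.
elim: k => [|k [IH1 IH2]]; first by rewrite /= !mul0r sin0 !mul1r.
split=> //; rewrite chebSS mulrBl IH1 -(mulrA (2 * cos t)) IH2.
have -> : k.+2%:R * t = k.+1%:R * t + t by rewrite -natr1 mulrDl mul1r.
have -> : k%:R * t = k.+1%:R * t - t by rewrite -natr1 mulrDl mul1r addrK.
rewrite sinB sinD; ring.
Qed.

(** For b = cos (pi / M) the angle k * pi / M stays in [0, pi] exactly as long as
    k <= M, which is the bound on the length of alternating reduced words. *)
Lemma cheb_ge0_cos (R : realType) (M k : nat) : (2 <= M)%N -> (k <= M)%N ->
  0 <= cheb (cos (pi / M%:R : R)) k.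
Proof.
move=> M2 kM; have M0 : 0 < M%:R :> R by rewrite ltr0n (leq_trans _ M2).
have s0 : 0 < sin (pi / M%:R : R).
  apply: sin_gt0_pi; rewrite divr_gt0 ?pi_gt0//=.
  by rewrite ltr_pdivrMr// ltr_pMr ?pi_gt0// ltr1n.
rewrite -(pmulr_lge0 _ s0) cheb_sin; apply: sin_ge0_pi.
rewrite mulr_ge0 ?divr_ge0 ?pi_ge0 ?ler0n//=.
by rewrite mulrCA ler_piMr ?pi_ge0// ler_pdivrMr// mul1r ler_nat.
Qed.

(** For b >= 1 the sequence is nondecreasing, since 2 b - 1 >= 1; this is why
    weights c_ij >= 1 at infinite edges behave like the classical value 1. *)
Lemma cheb_ge0_ge1 (R : realType) (b : R) k : 1 <= b -> 0 <= cheb b k.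
Proof.
move=> b1; suff: 0 <= cheb b k <= cheb b k.+1 by case/andP.
elim: k => [|k /andP[IH0 IH1]]; first by rewrite /= lexx ler01.
rewrite (le_trans IH0 IH1) andTb chebSS; nra.
Qed.

(** * The geometric representation *)

Section Gram.
Context (R : realType) (n : nat) (m : 'I_n -> 'I_n -> option nat)
  (c : 'I_n -> 'I_n -> R).
Context (hm : coxeter_matrix m) (hc : coxeter_weights m c).

Lemma gram_sym : (coxeter_gram m c)^T = coxeter_gram m c.
Proof.
case: hm => _ ms _; apply/matrixP => i j; rewrite !mxE (ms j i).
by case E: (m i j) => [k//|]; case: (hc E) => ->.
Qed.

Lemma gram_diag i : coxeter_gram m c i i = 1.
Proof. by case: hm => m1 _ _; rewrite mxE m1 divr1 cospi opprK. Qed.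

Lemma gram_cheb_ge0 i j k : i != j ->
  (forall M, m i j = Some M -> (k <= M)%N) -> 0 <= cheb (- coxeter_gram m c i j) k.
Proof.
move=> ij kM; case: hm => _ _ m2; rewrite mxE.
case E: (m i j) => [M|]; rewrite opprK; first by rewrite cheb_ge0_cos ?(m2 _ _ _ ij E) ?kM.
by rewrite cheb_ge0_ge1//; case: (hc E).
Qed.

End Gram.

Definition nonneg_vec (R : realType) (n : nat) (x : 'rV[R]_n) := forall j, 0 <= x 0 j.

Section Action.
Context (R : realType) (n : nat) (m : 'I_n -> 'I_n -> option nat)
  (c : 'I_n -> 'I_n -> R) (W : groupType) (s : 'I_n -> W)
  (act : W -> 'rV[R]_n -> 'rV[R]_n).
Context (hWS : coxeter_system m s) (hc : coxeter_weights m c)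
  (hact : geometric_action (coxeter_gram m c) s act).

Local Notation B := (coxeter_gram m c).
Local Notation alpha := (simple_root R).

Lemma system_matrix : coxeter_matrix m. Proof. by case: hWS. Qed.

Lemma system_gram_sym : B^T = B.
Proof. exact: gram_sym system_matrix hc. Qed.

Local Notation bformE := (bformE system_gram_sym).

Lemma bform_alpha i : bform B (alpha i) (alpha i) = 1.
Proof. by rewrite bform_simple gram_diag//; exact: system_matrix. Qed.

Lemma act1 x : act 1%g x = x. Proof. by case: hact. Qed.

Lemma actM v w x : act (v * w)%g x = act v (act w x).
Proof. by case: hact. Qed.

Lemma act_gen i x : act (s i) x = x - (2 * bform B x (alpha i)) *: alpha i.
Proof. by case: hact => _ _ ->; rewrite /reflection bform_alpha divr1. Qed.

Lemma gen_ind (P : W -> Prop) :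
  P 1%g -> (forall i w, P w -> P (s i * w)%g) -> forall w, P w.
Proof.
move=> P1 PS w; case: hWS => _ _ /(_ w)[u ->] _.
by elim: u => [|i u IH]; rewrite ?big_nil// big_cons; apply: PS.
Qed.

Lemma act_linear w a x y : act w (a *: x + y) = a *: act w x + act w y.
Proof.
elim/gen_ind: w => [|i w IH]; first by rewrite !act1.
by rewrite !actM IH !act_gen !bformE; apply/matrixP => k j; rewrite !mxE; ring.
Qed.

Lemma actD w x y : act w (x + y) = act w x + act w y.
Proof. by have := act_linear w 1 x y; rewrite !scale1r. Qed.

Lemma act0 w : act w 0 = 0.
Proof. by apply: (addrI (act w 0)); rewrite -actD !addr0. Qed.

Lemma actZ w a x : act w (a *: x) = a *: act w x.
Proof. by have := act_linear w a x 0; rewrite act0 !addr0. Qed.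

Lemma actN w x : act w (- x) = - act w x.
Proof. by rewrite -[in LHS]scaleN1r actZ scaleN1r. Qed.

Lemma act_bform w x y : bform B (act w x) (act w y) = bform B x y.
Proof.
elim/gen_ind: w => [|i w IH]; first by rewrite !act1.
by rewrite !actM !act_gen bform_reflection ?IH ?bform_alpha//; exact: system_gram_sym.
Qed.

Lemma actK w x : act w^-1%g (act w x) = x.
Proof. by rewrite -actM mulVg act1. Qed.

Lemma actVK w x : act w (act w^-1%g x) = x.
Proof. by rewrite -actM mulgV act1. Qed.

(** Every root is W-conjugate to a simple one, so the reflection in it is the
    corresponding conjugate of a generator. *)
Lemma root_reflection g : coxeter_roots act g ->
  exists w, forall x, act w x = x - (2 * bform B x g) *: g.
Proof.
move=> [w [i ->]]; exists (w * s i * w^-1)%g => x.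
rewrite !actM act_gen actD actVK actN actZ.
by rewrite -[in bform B (act _ x) _](act_bform w) actVK.
Qed.

Lemma root_norm g : coxeter_roots act g -> bform B g g = 1.
Proof. by move=> [w [i ->]]; rewrite act_bform bform_alpha. Qed.

Lemma gen_relation i j k : m i j = Some k -> ((s i * s j) ^+ k = 1)%g.
Proof. by case: hWS => _ h _ _; exact: h. Qed.

Lemma gen_sqr i : (s i * s i = 1)%g.
Proof. by have := @gen_relation i i 1; case: system_matrix => -> _ _; apply. Qed.

Lemma inv_gen i : (s i)^-1%g = s i.
Proof. by apply: mulg1_eq; exact: gen_sqr. Qed.

Lemma genK i w : (w * s i * s i = w)%g.
Proof. by rewrite -mulgA gen_sqr mulg1. Qed.

(** ** Word length *)

Lemma ex_word w : exists k, `[< exists2 u : seq 'I_n, size u = k & w = (\prod_(i <- u) s i)%g >].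
Proof.
by case: hWS => _ _ /(_ w)[u wu] _; exists (size u); apply/asboolP; exists u.
Qed.

Definition word_length w : nat := ex_minn (ex_word w).
Local Notation len := word_length.

Lemma len_word u : (len (\prod_(i <- u) s i)%g <= size u)%N.
Proof.
by rewrite /len; case: ex_minnP => k _; apply; apply/asboolP; exists u.
Qed.

Lemma reduced_word w : exists2 u, size u = len w & w = (\prod_(i <- u) s i)%g.
Proof. by rewrite /len; case: ex_minnP => k /asboolP. Qed.

Lemma lenM v w : (len (v * w)%g <= len v + len w)%N.
Proof.
have [u <- ->] := reduced_word v; have [u' <- ->] := reduced_word w.
by rewrite -big_cat -size_cat len_word.
Qed.

Lemma len1 : len 1%g = 0.
Proof. by apply/eqP; rewrite -leqn0; have := len_word [::]; rewrite big_nil. Qed.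

Lemma len_gen i : (len (s i) <= 1)%N.
Proof. by have := len_word [:: i]; rewrite big_seq1. Qed.

Lemma right_descent w : w <> 1%g -> exists i, (len (w * s i)%g < len w)%N.
Proof.
have [u <- ->] := reduced_word w; case/lastP: u => [|u i]; first by rewrite big_nil.
move=> _; exists i; rewrite size_rcons ltnS -cats1 big_cat big_seq1 genK.
exact: len_word.
Qed.

(** ** Alternating words *)

(** Letters are counted from the right end of the word, which is the end that
    acts first; [altword a b k] is the product of k letters ending in a. *)
Definition altletter (a b : 'I_n) k := if odd k then b else a.

Fixpoint altword (a b : 'I_n) k : W :=
  if k is k'.+1 then (s (altletter a b k') * altword a b k')%g else 1%g.

Lemma altletterSr a b k : altletter a b k.+1 = altletter b a k.
Proof. by rewrite /altletter /=; case: odd. Qed.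

Lemma altwordSr a b k : altword a b k.+1 = (altword b a k * s a)%g.
Proof.
elim: k => [|k IH]; first by rewrite /= /altletter /= mulg1 mul1g.
by rewrite -[LHS]/(s (altletter a b k.+1) * altword a b k.+1)%g IH /= altletterSr mulgA.
Qed.

Lemma len_altword a b k : (len (altword a b k) <= k)%N.
Proof.
elim: k => [|k IH]; first by rewrite len1.
rewrite (leq_trans (lenM _ _))// -add1n; exact: leq_add (len_gen _) IH.
Qed.

Lemma expgM_swap (x y : W) k : ((x * y) ^+ k * x = x * (y * x) ^+ k)%g.
Proof.
elim: k => [|k IH]; first by rewrite mul1g mulg1.
by rewrite !expgS -!mulgA IH.
Qed.

(** The quotient of the two alternating words of length j collapses to a j-th
    power of a product of the two generators, which is trivial for j = m_ab. *)
Lemma braid a b k : m a b = Some k -> altword a b k = altword b a k.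
Proof.
move=> mab.
have key j : (altword b a j * (altword a b j)^-1 =
             (s (altletter a b j) * s (altletter b a j)) ^+ j)%g.
  elim: j => [|j IH]; first by rewrite mul1g invg1.
  rewrite /= invgM -!mulgA (mulgA (altword b a j)) IH.
  rewrite inv_gen !altletterSr expgS.
  by rewrite -mulgA expgM_swap.
apply/esym/divg1_eq; rewrite key /altletter; case: odd; apply: gen_relation => //.
by case: system_matrix => _ <-.
Qed.

(** Alternate reflections never leave the plane of the two simple roots; the
    larger index belongs to the simple root whose reflection acted last. *)
Lemma act_altword a b k : a != b ->
  act (altword a b k) (alpha b) =
  cheb (- B a b) k.+1 *: alpha (altletter b a k) + cheb (- B a b) k *: alpha (altletter a b k).
Proof.
move=> ab; elim: k => [|k IH]; first by rewrite act1 scale1r scale0r addr0.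
rewrite [altword _ _ _]/= actM IH act_gen chebSS !altletterSr !bformE bform_alpha bform_simple.
have -> : B (altletter b a k) (altletter a b k) = B a b.
  rewrite /altletter; case: odd => //.
  by rewrite -[in RHS]system_gram_sym [RHS]mxE.
by apply/matrixP => p q; rewrite !mxE; ring.
Qed.

Lemma nonneg_alpha (i : 'I_n) : nonneg_vec (alpha i).
Proof. by move=> j; rewrite /simple_root mxE; case: (_ && _). Qed.

Lemma nonneg_comb (x y : 'rV[R]_n) a b : 0 <= a -> 0 <= b ->
  nonneg_vec x -> nonneg_vec y -> nonneg_vec (a *: x + b *: y).
Proof. by move=> a0 b0 x0 y0 j; rewrite !mxE addr_ge0// mulr_ge0. Qed.

(** The fundamental positivity property of Coxeter groups, by induction on the
    length of w.  Take the last letter t of a reduced word of w and strip off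
    letters t, i, t, i, ... on the right as long as this shortens the element.  The remaining factor v
    is shortened by neither t nor i, so v alpha_t and v alpha_i are
    nonnegative by induction.  The stripped word is shorter than m_ti, as
    otherwise the braid relation would make w end in i; hence it maps
    alpha_i to a nonnegative combination of alpha_t and alpha_i. *)
Theorem act_simple_root_ge0 w i : (len w <= len (w * s i)%g)%N ->
  nonneg_vec (act w (alpha i)).
Proof.
elim: {w}(len w).+1 {-2}w i (leqnn (len w).+1) => // N IH w i.
rewrite ltnS => wN wi.
have [->|/eqP/right_descent[t wt]] := eqVneq w 1%g; first by rewrite act1; exact: nonneg_alpha.
have ti : t != i by apply: contraTneq wt => ->; rewrite -leqNgt.
(* v k is what remains of w after k letters have been stripped off. *)
pose v k := (w * (altword t i k)^-1)%g.
have vS k : v k.+1 = (v k * s (altletter t i k))%g by rewrite /v /= invgM inv_gen mulgA.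
have vw k : (v k * altword t i k)%g = w by rewrite /v mulgVK.
have v0 : v 0%N = w by rewrite -[RHS](vw 0%N) mulg1.
have desc k : (forall j, (j < k)%N -> (len (v j.+1) < len (v j))%N) -> (len (v k) + k <= len w)%N.
  elim: k => [|k IHk] dk; first by rewrite v0 addn0.
  apply: leq_trans (IHk _); last by move=> j jk; apply: dk; exact: leqW.
  by rewrite addnS -addSn leq_add2r dk.
have exj : exists j, (len (v j) <= len (v j.+1))%N.
  apply: contrapT => /forallNP h.
  have /desc : forall j, (j < (len w).+1)%N -> (len (v j.+1) < len (v j))%N.
    by move=> j _; rewrite ltnNge; apply/negP; exact: h.
  by rewrite addnS ltnNge leq_addl.
case: (ex_minnP exj) => j vj jmin.
have dj k : (k < j)%N -> (len (v k.+1) < len (v k))%N.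
  by move=> kj; rewrite ltnNge; apply: contraTN kj => /jmin; rewrite leqNgt.
have j0 : (0 < j)%N.
  by case: (posnP j) vj => // ->; rewrite vS v0 leqNgt wt.
have jw := desc j dj.
have vN : (len (v j) < N)%N.
  by rewrite (leq_trans _ wN)// (leq_trans _ jw)// -addn1 leq_add2l.
have pos1 : nonneg_vec (act (v j) (alpha (altletter t i j))).
  by apply: IH => //; rewrite -vS.
have pos2 : nonneg_vec (act (v j) (alpha (altletter i t j))).
  have jp := prednK j0; rewrite -jp altletterSr; apply: IH; first by rewrite jp.
  by rewrite {2}vS genK; apply/ltnW/dj; rewrite jp.
(* Otherwise the braid relation exchanges the last letters t and i of w. *)
have jM M : m t i = Some M -> (j < M)%N.
  move=> tiM; rewrite ltnNge; apply/negP => Mj.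
  have M0 : (0 < M)%N by case: system_matrix => _ _ /(_ _ _ _ ti tiM); exact: leq_trans.
  have MW : (len (v M) + M <= len w)%N by apply: desc => k kM; apply: dj; exact: leq_trans Mj.
  case: M tiM M0 {Mj} MW => // M tiM _ MW.
  move: wi; rewrite -{2}(vw M.+1) (braid tiM) altwordSr mulgA genK leqNgt => /negP; apply.
  apply: leq_ltn_trans (lenM _ _) _; apply: leq_trans MW; rewrite -addnS leq_add2l.
  by rewrite ltnS len_altword.
rewrite -(vw j) actM act_altword// actD !actZ.
apply: nonneg_comb => //; apply: (gram_cheb_ge0 system_matrix hc ti) => M /jM //.
exact: ltnW.
Qed.

(** A nontrivial w has a right descent i, and then w alpha_i = - (w s_i) alpha_i
    is nonpositive.  This is discreteness in algebraic form: the hypothesis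
    holds for every w that is close enough to the identity. *)
Lemma act_simple_root_gt0 w : (forall i, 0 < act w (alpha i) 0 i) -> w = 1%g.
Proof.
move=> pos; apply: contrapT => /right_descent[i wi]; have := pos i.
have /act_simple_root_ge0 /(_ i) : (len (w * s i)%g <= len (w * s i * s i)%g)%N.
  by rewrite genK ltnW.
rewrite actM act_gen bform_alpha; set x := alpha i - _.
have -> : x = - alpha i by rewrite /x mulr1 scaler_nat mulr2n opprD addrA subrr sub0r.
by rewrite actN mxE oppr_ge0 leNgt => /negP.
Qed.

End Action.

(** * Boundedness and discreteness of the roots *)

Section RowNorm.
Context (R : realType) (n : nat).
Implicit Types x y : 'rV[R]_n.

Lemma le_coord_norm x j : `|x 0 j| <= `|x|.
Proof.
rewrite [leRHS]/Num.norm /= mx_normrE; apply/bigmax_geP; right => /=.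
by exists (ord0, j).
Qed.

Lemma norm_le_coord x (a : R) : 0 <= a -> (forall j, `|x 0 j| <= a) -> `|x| <= a.
Proof.
move=> a0 xa; rewrite [leLHS]/Num.norm /= mx_normrE; apply/bigmax_leP; split=> //.
by move=> [i j] _ /=; rewrite ord1.
Qed.

Lemma norm_simple_root (i : 'I_n) : `|simple_root R i| <= 1.
Proof.
apply: norm_le_coord => // j; rewrite /simple_root mxE.
by case: (_ && _); rewrite ?normr1 ?normr0.
Qed.

Lemma bform_bounded (B : 'M[R]_n) :
  exists2 K : R, 0 < K & forall x y, `|bform B x y| <= K * `|x| * `|y|.
Proof.
exists (1 + \sum_j \sum_i `|B i j|).
  by rewrite ltr_pwDl ?ltr01// sumr_ge0// => j _; rewrite sumr_ge0.
move=> x y; apply: (@le_trans _ _ ((\sum_j \sum_i `|B i j|) * `|x| * `|y|)); last first.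
  by rewrite !ler_wpM2r// lerDr.
rewrite /bform mxE (le_trans (ler_norm_sum _ _ _))// !mulr_suml.
apply: ler_sum => j _; rewrite mxE normrM mxE.
rewrite ler_pM ?le_coord_norm// (le_trans (ler_norm_sum _ _ _))// mulr_suml.
by apply: ler_sum => i _; rewrite normrM mulrC ler_wpM2l ?le_coord_norm.
Qed.

Lemma closed_le_norm (M : R) : closed [set x : 'rV[R]_n | `|x| <= M].
Proof.
apply: (@closed_comp _ _ (fun x : 'rV[R]_n => `|x|) [set r | r <= M]).
  by move=> x _; exact: norm_continuous.
exact: closed_le.
Qed.

(** The compactness of balls, in the form in which it serves below: infinitely
    many terms are close to a common vector. *)
Lemma bounded_seq_cluster (u : nat -> 'rV[R]_n) (M : R) N :
  (forall k, (N <= k)%N -> `|u k| <= M) ->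
  exists g, forall e, 0 < e -> forall K, exists2 k, (K <= k)%N & `|u k - g| < e.
Proof.
move=> uM.
have cA : compact [set x : 'rV[R]_n | `|x| <= M].
  apply: bounded_closed_compact; last exact: closed_le_norm.
  by exists M; split=> [|b Mb x /= /le_trans]; [exact: num_real | apply; exact: ltW].
have [|g [_ gu]] := cA (u @ \oo) _; first by exists N => //= k; exact: uM.
exists g => e e0 K.
have [||_ [[k /= Kk <-] gk]] := gu (u @` [set k | (K <= k)%N]) (ball g e).
- by exists K => //= k Kk; exists k.
- exact: nbhsx_ballx.
by exists k => //; move: gk; rewrite -ball_normE /ball_/= distrC.
Qed.

End RowNorm.

Section Discrete.
Context (R : realType) (n : nat) (m : 'I_n -> 'I_n -> option nat)
  (c : 'I_n -> 'I_n -> R) (W : groupType) (s : 'I_n -> W)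
  (act : W -> 'rV[R]_n -> 'rV[R]_n).
Context (hWS : coxeter_system m s) (hc : coxeter_weights m c)
  (hact : geometric_action (coxeter_gram m c) s act).

Local Notation B := (coxeter_gram m c).
Local Notation alpha := (simple_root R).
Local Notation bformE := (bformE (system_gram_sym hWS hc)).

Lemma root_reflection_eq a b : coxeter_roots act a -> coxeter_roots act b ->
  b - (2 * bform B b a) *: a = - b -> a = b \/ a = - b.
Proof.
move=> /(root_norm hWS hc hact) a1 /(root_norm hWS hc hact) b1 h.
have {h} bE : b = bform B b a *: a.
  apply: (@scalerI _ _ 2); first by rewrite pnatr_eq0.
  by apply/eqP; rewrite scalerA scaler_nat mulr2n -subr_eq0 addrAC h addNr.
move: (b1); rewrite {1 2}bE !bformE a1 => /eqP; rewrite mulr1 -expr2 sqrf_eq1.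
by case/orP=> /eqP ba; move: bE; rewrite ba ?scale1r ?scaleN1r => ->; [left|right; rewrite opprK].
Qed.

(** Two close roots a and b of bounded size have close reflections, so the
    product of their reflections moves each simple root by less than 1 and
    must be trivial; reflections determine roots up to sign. *)
Lemma roots_separated (M : R) : exists2 d : R, 0 < d &
  forall a b, coxeter_roots act a -> coxeter_roots act b ->
  `|a| <= M -> `|b| <= M -> `|a - b| < d -> a = b \/ a = - b.
Proof.
have [K K0 BK] := bform_bounded B.
have [M0|M0] := ltP M 0.
  by exists 1 => // a b _ _ aM; move: (normr_ge0 a); rewrite leNgt (le_lt_trans aM M0).
(* The first factor bounds the norm of the reflection in a; the second one
   is a Lipschitz constant for the reflection of a simple root as a function
   of the root it is reflected in. *)
pose C := (1 + 2 * K * M * M) * (4 * K * M) + 1.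
have C0 : 0 < C by rewrite ltr_wpDl// !mulr_ge0// ?addr_ge0// ?mulr_ge0// ltW.
exists C^-1; first by rewrite invr_gt0.
move=> a b ra rb aM bM ab.
have [wa waE] := root_reflection hWS hc hact ra.
have [wb wbE] := root_reflection hWS hc hact rb.
have wa2 x : act wa (act wa x) = x.
  rewrite !waE !bformE (root_norm hWS hc hact ra).
  by apply/matrixP => p q; rewrite !mxE; ring.
suff w1 : (wa * wb = 1)%g.
  apply: root_reflection_eq => //.
  rewrite -waE -[b in act wa b](opprK b) (actN hWS hact).
  have -> : - b = act wb b.
    by rewrite wbE (root_norm hWS hc hact rb); apply/matrixP => p q; rewrite !mxE; ring.
  by rewrite -(actM hact) w1 (act1 hact) wbE (root_norm hWS hc hact rb);
     apply/matrixP => p q; rewrite !mxE; ring.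
apply: (act_simple_root_gt0 hWS hc hact) => i.
pose y := (2 * bform B (alpha i) a) *: (a - b) + (2 * bform B (alpha i) (a - b)) *: b.
have -> : act (wa * wb)%g (alpha i) = alpha i + act wa y.
  rewrite (actM hact) -[X in X + act wa y]wa2 -(actD hWS hact); congr (act wa _).
  by rewrite wbE waE /y !bformE; apply/matrixP => p q; rewrite !mxE; ring.
have nB x : `|bform B (alpha i) x| <= K * `|x|.
  by rewrite (le_trans (BK _ _))// ler_wpM2r// ler_piMr ?norm_simple_root// ltW.
have ny : `|y| <= 4 * K * M * `|a - b|.
  rewrite (le_trans (ler_normD _ _))// !normrZ ger0_norm//.
  have := nB a; have := nB (a - b); have := normr_ge0 (a - b).
  have := normr_ge0 b; have := normr_ge0 (bform B (alpha i) a).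
  have := normr_ge0 (bform B (alpha i) (a - b)).
  move: `|a - b| `|bform _ _ a| `|bform _ _ (a - b)| => u p q q0 p0 b0 u0 qK pK.
  have h1 : p * u <= K * M * u.
    by rewrite ler_wpM2r// (le_trans pK)// ler_wpM2l// ltW.
  have h2 : q * `|b| <= K * u * M by rewrite ler_pM.
  by rewrite -!mulrA; nra.
clearbody y.
have nay : `|act wa y| <= (1 + 2 * K * M * M) * `|y|.
  rewrite waE (le_trans (ler_normB _ _))// [leRHS]mulrDl mul1r lerD2l !normrZ ger0_norm//.
  have h : `|bform B y a| <= K * `|y| * M by rewrite (le_trans (BK _ _))// ler_wpM2l// mulr_ge0// ltW.
  have := ler_pM (normr_ge0 _) (normr_ge0 a) h aM.
  by move: (`|bform B y a|) => p hp; nra.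
have lt1 : `|act wa y| < 1.
  apply: le_lt_trans nay _.
  apply: (@le_lt_trans _ _ (C * `|a - b|)); last by rewrite -ltr_pdivlMl ?mulr1.
  apply: (@le_trans _ _ ((1 + 2 * K * M * M) * (4 * K * M * `|a - b|))).
    by rewrite ler_wpM2l// ?addr_ge0// ?mulr_ge0// ltW.
  by rewrite mulrA ler_wpM2r// /C lerDl.
have := le_lt_trans (le_coord_norm (act wa y) i) lt1.
rewrite ltr_norml => /andP[+ _]; rewrite mxE /simple_root mxE !eqxx /=; lra.
Qed.

(** A bounded injective sequence would have three distinct terms close to a
    common vector; by separation the last two would both be the opposite of
    the first one. *)
Lemma injective_roots_unbounded (gamma : nat -> 'rV[R]_n) (M : R) N :
  injective gamma -> (forall k, coxeter_roots act (gamma k)) ->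
  exists2 k, (N <= k)%N & M < `|gamma k|.
Proof.
move=> ginj groot; apply: contrapT => h.
have bnd k : (N <= k)%N -> `|gamma k| <= M.
  by move=> Nk; rewrite leNgt; apply/negP => Mk; apply: h; exists k.
have [d d0 sep] := roots_separated M.
have [g gcl] := bounded_seq_cluster bnd.
have d20 : 0 < d / 2 by rewrite divr_gt0.
have [k1 N1 g1] := gcl _ d20 N.
have [k2 N2 g2] := gcl _ d20 k1.+1.
have [k3 N3 g3] := gcl _ d20 k2.+1.
have close k l : (N <= k)%N -> (N <= l)%N -> `|gamma k - g| < d / 2 ->
    `|gamma l - g| < d / 2 -> (k < l)%N -> gamma k = - gamma l.
  move=> Nk Nl gk gl kl.
  have [|/ginj E|//] := sep _ _ (groot k) (groot l) (bnd _ Nk) (bnd _ Nl).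
    rewrite -[_ - _](subrKA g) (le_lt_trans (ler_normD _ _))// (splitr d) ltrD//.
    by rewrite distrC.
  by move: kl; rewrite E ltnn.
have N2' : (N <= k2)%N by rewrite (leq_trans N1)// ltnW.
have N3' : (N <= k3)%N by rewrite (leq_trans N2')// ltnW.
have := close _ _ N1 N2' g1 g2 N2.
rewrite (close _ _ N1 N3' g1 g3 (ltn_trans N2 N3)) => /oppr_inj/ginj E.
by move: N3; rewrite E ltnn.
Qed.

End Discrete.

(** * The topology of projective space *)

Section Projective.
Context (R : realType) (n : nat).
Implicit Types (x y : nzvec R n).

Definition to_nzvec (v : 'rV[R]_n) (v0 : v != 0) : nzvec R n :=
  exist _ v (mem_set v0).

Lemma to_nzvecK v (v0 : v != 0) : nzvec_val (to_nzvec v0) = v.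
Proof. by rewrite /nzvec_val set_valE. Qed.

Lemma nzvec_neq0 x : nzvec_val x != 0.
Proof. by case: x => v v0; rewrite /nzvec_val set_valE /=; exact: set_mem v0. Qed.

Lemma nzvec_val_inj : injective (@nzvec_val R n).
Proof. by move=> x y; rewrite /nzvec_val set_valE; exact: val_inj. Qed.

Lemma line_eqP x y :
  line x = line y <-> exists2 a : R, a != 0 & nzvec_val y = a *: nzvec_val x.
Proof.
split=> [/eqmodP/andP[_ /sub_rVP[a ya]]|[a a0 ya]].
  exists a => //; apply: contraNneq (nzvec_neq0 y) => a0.
  by rewrite ya a0 scale0r.
apply/eqmodP; rewrite /= /same_line ya scalemx_sub// andbT.
by rewrite -{1}[nzvec_val x](scalerK a0) scalemx_sub.
Qed.

Lemma line_surj (p : projspace R n) : exists x, p = line x.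
Proof. by exists (repr p); rewrite /line reprK. Qed.

(** The projection onto projective space is continuous and open: the preimage
    of the lines meeting a ball is a union of rescaled balls. *)
Lemma nbhs_lineP x (U : set (projspace R n)) : nbhs (line x) U <->
  exists2 e : R, 0 < e & forall y, `|nzvec_val y - nzvec_val x| < e -> U (line y).
Proof.
split=> [/pi_continuous|[e e0 eU]].
  rewrite nbhsE => -[V [[A oA <-] Ax] VU].
  have /nbhs_ballP[e /= e0 eA] : nbhs (set_val x) A by apply: open_nbhs_nbhs.
  exists e => // y; rewrite distrC => yx; apply: VU; apply: eA.
  by rewrite -ball_normE.
rewrite nbhsE; exists [set p | exists2 y, `|nzvec_val y - nzvec_val x| < e & p = line y].
  split; last by exists x => //; rewrite subrr normr0.
  rewrite -[open _]/(open ((@line R n) @^-1` _)) (_ : _ @^-1` _ = \bigcup_(a in [set a : R | a != 0])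
      [set z : nzvec R n | `|a *: nzvec_val z - nzvec_val x| < e]); last first.
    apply/seteqP; split=> z /=.
      by move=> [y yx /line_eqP[a a0 ya]]; exists a => //=; rewrite -ya.
    move=> [a /= a0 zx]; have v0 : a *: nzvec_val z != 0.
      by rewrite scaler_eq0 negb_or a0 nzvec_neq0.
    exists (to_nzvec v0); first by rewrite to_nzvecK.
    by apply/line_eqP; exists a; rewrite ?to_nzvecK.
  apply: bigcup_open => a _.
  exists [set v : 'rV[R]_n | `|a *: v - nzvec_val x| < e] => //.
  apply: (@open_comp _ _ (fun v : 'rV[R]_n => `|a *: v - nzvec_val x|) [set r | r < e]); last exact: open_lt.
  move=> v _; apply: continuous_comp; last exact: norm_continuous.
  apply: continuousD; last exact: cst_continuous.
  exact: scaler_continuous.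
by move=> _ [y yx ->]; exact: eU.
Qed.

Lemma closure_lineP x (E : set (projspace R n)) : closure E (line x) <->
  forall e : R, 0 < e -> exists2 y, E (line y) & `|nzvec_val y - nzvec_val x| < e.
Proof.
split=> [cE e e0|h U /nbhs_lineP[e e0 eU]].
  have [|p [Ep [y yx py]]] := cE [set p | exists2 y, `|nzvec_val y - nzvec_val x| < e & p = line y].
    by apply/nbhs_lineP; exists e => // y yx; exists y.
  by exists y => //; rewrite -py.
by have [y Ey /eU Uy] := h e e0; exists (line y).
Qed.

Lemma cvg_lineP x (u : nat -> nzvec R n) :
  (fun k => line (u k)) @ \oo --> line x <->
  forall e : R, 0 < e -> exists N, forall k, (N <= k)%N ->
    exists2 a : R, a != 0 & `|a *: nzvec_val (u k) - nzvec_val x| < e.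
Proof.
split=> [cu e e0|h U /nbhs_lineP[e e0 eU]].
  have [|N _ uN] := cu [set p | exists2 y, `|nzvec_val y - nzvec_val x| < e & p = line y].
    by apply/nbhs_lineP; exists e => // y yx; exists y.
  exists N => k /uN [y yx /line_eqP[a a0 ya]].
  by exists a; rewrite // -ya.
have [N uN] := h e e0; exists N => // k /uN [a a0 ux].
have v0 : a *: nzvec_val (u k) != 0 by rewrite scaler_eq0 negb_or a0 nzvec_neq0.
have Ek : line (u k) = line (to_nzvec v0).
  by apply/line_eqP; exists a; rewrite ?to_nzvecK.
by rewrite /preimage /= Ek; apply: eU; rewrite to_nzvecK.
Qed.

End Projective.

(** * Limit roots are approximated by eigendirections *)

(** The roots of the quadratic polynomial have product e^2 and distinct absolute
    values, so the smaller one is below |e|. *)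
Lemma quadratic_small_root (R : realType) (b e : R) : e != 0 -> e ^+ 2 < b ^+ 2 ->
  exists t, [/\ t ^+ 2 + 2 * b * t + e ^+ 2 = 0, `|t| <= `|e| & t ^+ 2 != e ^+ 2].
Proof.
move=> e0 eb.
wlog b0 : b eb / 0 < b.
  move=> IH; have [b0|b0|b0] := ltgtP b 0.
  - have [||t [t1 t2 t3]] := IH (- b); rewrite ?sqrrN ?oppr_gt0//.
    by exists (- t); rewrite normrN !sqrrN; split=> //; rewrite -t1; ring.
  - exact: IH.
  - by move: eb; rewrite b0 expr0n/= ltNge sqr_ge0.
pose q := Num.sqrt (b ^+ 2 - e ^+ 2).
have qq : q ^+ 2 = b ^+ 2 - e ^+ 2 by rewrite sqr_sqrtr// subr_ge0 ltW.
have q0 : 0 <= q by exact: sqrtr_ge0.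
have tE : (q - b) ^+ 2 + 2 * b * (q - b) + e ^+ 2 = 0.
  by rewrite -[X in _ + X](subKr (b ^+ 2)) -qq; ring.
have qb : q <= b by rewrite -ler_sqr ?nnegrE ?(ltW b0)// qq lerBlDr lerDl sqr_ge0.
have tn : (q - b) ^+ 2 != e ^+ 2.
  apply/negP => /eqP te; have e2 : 0 < e ^+ 2 by rewrite exprn_even_gt0.
  nra.
exists (q - b); split=> //.
have : (q - b) ^+ 2 <= e ^+ 2 by nra.
by rewrite -[in X in X -> _]real_normK ?num_real// -[X in _ <= X -> _]real_normK ?num_real// ler_sqr ?nnegrE.
Qed.

(** When e g + t a is isotropic, which is what the quadratic equation says, the
    two reflections of the plane spanned by a and g compose to an isometry of
    that plane that fixes its isotropic lines, with t^2 / e^2 and e^2 / t^2 as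
    eigenvalues. *)
Lemma product_of_reflections (R : realType) (n : nat) (B : 'M[R]_n)
    (Bsym : B^T = B) (a g : 'rV[R]_n) (e t : R) :
  bform B a a = 1 -> bform B g g = 1 -> e != 0 ->
  t ^+ 2 + 2 * bform B (e *: g) a * t + e ^+ 2 = 0 ->
  let y := e *: g + t *: a in let z := y - (2 * bform B y g) *: g in
  z - (2 * bform B z a) *: a = (t ^+ 2 / e ^+ 2) *: y.
Proof.
move=> a1 g1 e0 ht y z; move: ht.
rewrite /z /y !(bformE Bsym) a1 g1 (bformC Bsym a g).
move: (bform B g a) => b ht.
have hp : e * (e + 2 * t * b) = - t ^+ 2.
  by apply/eqP; rewrite -subr_eq0 -[X in _ == X]ht; apply/eqP; ring.
apply/matrixP => i j; rewrite !mxE; move: (a i j) (g i j) => u v.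
have -> : t ^+ 2 / e ^+ 2 = - (e + 2 * t * b) / e.
  by rewrite -[t ^+ 2]opprK -hp; field.
apply: (mulfI e0); rewrite [RHS](_ : _ = - (e + 2 * t * b) * (e * v + t * u)); last by field.
have -> : - (e + 2 * t * b) * (e * v + t * u) =
   - e * (e + 2 * t * b) * v - (e + 2 * t * b) * t * u by ring.
apply/eqP; rewrite -subr_eq0; apply/eqP.
transitivity (u * (2 * b) * (e * (e + 2 * t * b) + t ^+ 2)); first by ring.
by rewrite hp addNr mulr0.
Qed.

Lemma lorentzian_unitmx (R : realType) (n : nat) (B : 'M[R]_n) :
  lorentzian B -> B \in unitmx.
Proof.
move=> [n1 [P Pu PBP]]; rewrite unitmxE unitfE.
have : \det (P *m B *m P^T) != 0.
  rewrite PBP det_diag; apply/prodf_neq0 => i _; rewrite mxE.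
  case: ifP => [|_]; first by rewrite oner_neq0.
  by rewrite (leq_trans (ltn_ord i)) ?oppr_eq0 ?oner_neq0//; case: n i {P Pu PBP B n1} => [[]|k _] //; rewrite addn1.
by rewrite !det_mulmx !mulf_eq0 !negb_or => /andP[/andP[]].
Qed.

Section LimitRoots.
Context (R : realType) (n : nat) (m : 'I_n -> 'I_n -> option nat)
  (c : 'I_n -> 'I_n -> R) (W : groupType) (s : 'I_n -> W)
  (act : W -> 'rV[R]_n -> 'rV[R]_n).
Context (hWS : coxeter_system m s) (hc : coxeter_weights m c)
  (hact : geometric_action (coxeter_gram m c) s act).

Local Notation B := (coxeter_gram m c).
Local Notation alpha := (simple_root R).
Local Notation bformE := (bformE (system_gram_sym hWS hc)).

Lemma act_eigen_exp w x (l : R) k :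
  act w x = l *: x -> act (w ^+ k)%g x = l ^+ k *: x.
Proof.
move=> wx; elim: k => [|k IH]; first by rewrite (act1 hact) scale1r.
by rewrite expgSr (actM hact) wx (actZ hWS hact) IH scalerA exprS.
Qed.

Lemma nonunimodular_infinite_order w x (l : R) : x != 0 ->
  act w x = l *: x -> `|l| <> 1 -> infinite_order w.
Proof.
move=> x0 wx l1 k k0 wk; apply: l1.
have := act_eigen_exp k wx; rewrite wk (act1 hact) => /eqP.
rewrite -subr_eq0 -[X in X - _]scale1r -scalerBl scaler_eq0 (negbTE x0) orbF subr_eq0.
move=> /eqP/esym lk; apply/eqP; rewrite -(@pexpr_eq1 _ _ k) //.
by rewrite -normrX lk normr1.
Qed.

(** Near a limit root x pick a multiple a g of a root g; as g is long, a is
    small.  For a simple root alpha_i not orthogonal to x the pairing of a g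
    with alpha_i dominates a, so the plane of g and alpha_i has signature
    (1, 1) and one of its isotropic lines is close to a g: a g + t alpha_i
    with |t| <= |a|.  The product of the two reflections is the required
    element of W. *)
Lemma limit_roots_sub_closure (Bu : B \in unitmx) :
  limit_roots act `<=` closure (nonunimodular_directions act).
Proof.
move=> p; have [x ->] := line_surj p => -[gamma [ginj groot /cvg_lineP gx]].
apply/closure_lineP => e e0.
have [i ix] := bform_nondeg Bu (nzvec_neq0 x).
have [K K0 BK] := bform_bounded B.
pose b := bform B (nzvec_val x) (alpha i).
have b0 : 0 < `|b| by rewrite normr_gt0 /b (bformC (system_gram_sym hWS hc)).
(* eta keeps the pairing with alpha_i above |b| / 2 and kap is the size that a
   must have to be dominated by that pairing and by e. *)
pose eta := Num.min (e / 2) (`|b| / 2 / K).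
have eta0 : 0 < eta by rewrite lt_min !divr_gt0.
pose kap := Num.min (`|b| / 2) (e / 2).
have kap0 : 0 < kap by rewrite lt_min !divr_gt0.
have [N gN] := gx _ eta0.
have ginj' : injective (fun k => nzvec_val (gamma k)) by move=> k l /nzvec_val_inj/ginj.
have [k /gN[a a0 ax] kbig] := injective_roots_unbounded hWS hc hact
  ((`|nzvec_val x| + eta) / kap) N ginj' groot.
move: ax kbig (groot k) => /=; move: (nzvec_val (gamma k)) => g ax kbig rg.
have g1 := root_norm hWS hc hact rg.
have akap : `|a| < kap.
  move: kbig; rewrite ltr_pdivrMr// => kbig.
  have : `|a| * `|g| < kap * `|g|.
    rewrite -normrZ [ltRHS]mulrC; apply: le_lt_trans kbig.
    rewrite -[a *: g](subrK (nzvec_val x)) (le_trans (ler_normD _ _))// addrC lerD2l.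
    exact: ltW.
  have : 0 <= `|g| by []; rewrite le_eqVlt => /predU1P[<-|g0]; first by rewrite !mulr0 ltxx.
  by rewrite ltr_pM2r.
pose bg := bform B (a *: g) (alpha i).
have abg : a ^+ 2 < bg ^+ 2.
  suff : `|a| < `|bg| by move=> h; rewrite -(real_normK (num_real a)) -(real_normK (num_real bg)) ltr_sqr ?nnegrE.
  have h : `|b - bg| < `|b| / 2.
    rewrite /b /bg -bformNl -bformDl (le_lt_trans (BK _ _))//.
    rewrite (@le_lt_trans _ _ (K * `|nzvec_val x - a *: g|))//.
      by rewrite ler_piMr ?norm_simple_root// mulr_ge0// ltW.
    by rewrite mulrC -ltr_pdivlMr// distrC (lt_le_trans ax)// ge_min lexx orbT.
  have : `|b| <= `|b - bg| + `|bg| by rewrite -{1}(subrK bg b) ler_normD.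
  have : `|a| < `|b| / 2 by rewrite (lt_le_trans akap)// ge_min lexx.
  lra.
have [t [tE ta tn]] := quadratic_small_root a0 abg.
have y0 : a *: g + t *: alpha i != 0.
  apply: contra tn; rewrite addr_eq0 => /eqP E.
  have := congr1 (fun v => bform B v v) E.
  by rewrite !bformE g1 (bform_alpha c hWS) !mulr1 mulrN opprK -!expr2 => ->.
exists (to_nzvec y0); last first.
  rewrite to_nzvecK addrAC (le_lt_trans (ler_normD _ _))// (splitr e) ltrD//.
    by rewrite (lt_le_trans ax)// ge_min lexx.
  rewrite normrZ; apply: (@le_lt_trans _ _ `|t|); first by rewrite ler_piMr ?norm_simple_root.
  by rewrite (le_lt_trans ta)// (lt_le_trans akap)// ge_min lexx orbT.
have [wg wgE] := root_reflection hWS hc hact rg.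
pose l := t ^+ 2 / a ^+ 2.
have wy : act (s i * wg)%g (a *: g + t *: alpha i) = l *: (a *: g + t *: alpha i).
  rewrite (actM hact) (act_gen hWS hact) wgE.
  exact: (product_of_reflections (system_gram_sym hWS hc) (bform_alpha c hWS i) g1 a0 tE).
have l1 : `|l| <> 1.
  rewrite ger0_norm ?divr_ge0 ?sqr_ge0// => /eqP.
  by rewrite -(inj_eq (mulIf (expf_neq0 2 a0))) divfK ?expf_neq0// mul1r (negbTE tn).
exists (s i * wg)%g, (to_nzvec y0), l; rewrite to_nzvecK; split=> //.
exact: nonunimodular_infinite_order y0 wy l1.
Qed.

End LimitRoots.

(** * Lorentzian geometry *)

(** Lagrange's identity: the defect is half a sum of squares. *)
Lemma cauchy_schwarz_sum (R : realType) (I : finType) (f g : I -> R) :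
  (\sum_i f i * g i) ^+ 2 <= (\sum_i f i ^+ 2) * (\sum_i g i ^+ 2).
Proof.
have : 0 <= \sum_i \sum_j (f i * g j - f j * g i) ^+ 2.
  by apply: sumr_ge0 => i _; apply: sumr_ge0 => j _; exact: sqr_ge0.
have -> : \sum_i \sum_j (f i * g j - f j * g i) ^+ 2 =
    (\sum_i \sum_j f i ^+ 2 * g j ^+ 2) + (\sum_i \sum_j g i ^+ 2 * f j ^+ 2)
    - 2 * \sum_i \sum_j (f i * g i) * (f j * g j).
  rewrite mulr_sumr -big_split -sumrB; apply: eq_bigr => i _.
  rewrite mulr_sumr -big_split -sumrB; apply: eq_bigr => j _ /=; ring.
rewrite -!big_distrlr /= -expr2 [X in _ + X - _]mulrC; lra.
Qed.

Lemma norm_mulmx_bounded (R : realType) (n : nat) (P : 'M[R]_n) :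
  exists2 K : R, 0 <= K &
    forall (u : 'rV[R]_n) r, 0 <= r -> (forall i, `|u 0 i| <= r) -> `|u *m P| <= K * r.
Proof.
exists (\sum_i \sum_j `|P i j|); first by do 2![apply: sumr_ge0 => ? _].
move=> u r r0 ur; apply: norm_le_coord => [|j].
  by rewrite mulr_ge0//; do 2![apply: sumr_ge0 => ? _].
rewrite mxE (le_trans (ler_norm_sum _ _ _))// mulr_suml; apply: ler_sum => i _.
rewrite normrM mulrC ler_pM// (bigD1 j)//= lerDl; exact: sumr_ge0.
Qed.

Section Lorentz.
Context (R : realType) (n : nat) (B : 'M[R]_n).
Context (hL : lorentzian B).

(** In Sylvester coordinates, orthogonality to t expresses the timelike
    coordinate of z through the spacelike ones, and Cauchy-Schwarz bounds it
    by a factor smaller than 1, because t is timelike. *)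
Lemma orthogonal_timelike_coercive t : bform B t t < 0 ->
  exists2 C : R, 0 <= C &
    forall z, bform B z t = 0 -> `|z| ^+ 2 <= C * bform B z z.
Proof.
case: hL => n1 [P Pu PBP]; case: n B n1 P Pu PBP t => [//|k] G _ P Pu PBP t.
pose co (v : 'rV[R]_k.+1) := v *m invmx P.
pose S v v' := \sum_(i < k) co v 0 (widen_ord (leqnSn k) i) * co v' 0 (widen_ord (leqnSn k) i).
have formE v v' : bform G v v' = S v v' - co v 0 ord_max * co v' 0 ord_max.
  have cK w : w = co w *m P by rewrite mulmxKV.
  rewrite {1}(cK v) {1}(cK v') /bform trmx_mul !mulmxA -2!(mulmxA (co v)) PBP.
  rewrite mul_mx_diag mxE big_ord_recr /= !mxE /= ltnn addn1 ltnSn; congr (_ + _); last by rewrite mulrN1 mulNr.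
  by apply: eq_bigr => i _; rewrite !mxE /= ltn_ord mulr1.
pose A v := \sum_(i < k) co v 0 (widen_ord (leqnSn k) i) ^+ 2.
have A0 v : 0 <= A v by apply: sumr_ge0 => i _; exact: sqr_ge0.
have SA v : S v v = A v by apply: eq_bigr => i _; rewrite expr2.
rewrite formE SA -expr2 => tt; set T := co t 0 ord_max in tt *.
have [K K0 KP] := norm_mulmx_bounded P.
have D0 : 0 < T ^+ 2 - A t by lra.
exists (K ^+ 2 * (T ^+ 2 / (T ^+ 2 - A t))).
  by rewrite mulr_ge0 ?sqr_ge0// divr_ge0 ?sqr_ge0// ltW.
move=> z zt; have CS : (S z t) ^+ 2 <= A z * A t by exact: cauchy_schwarz_sum.
move: zt; rewrite !formE SA -/T -expr2; set Z := co z 0 ord_max => zt.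
have {}CS : (Z * T) ^+ 2 <= A z * A t by rewrite (_ : Z * T = S z t)//; lra.
have ZA : Z ^+ 2 <= A z.
  have := A0 z; have := A0 t; move: CS; rewrite exprMn => CS At Az.
  have T2 : 0 < T ^+ 2 by lra.
  rewrite -(ler_pM2r T2) (le_trans CS)// ler_wpM2l//; lra.
have AB : A z <= T ^+ 2 / (T ^+ 2 - A t) * (A z - Z ^+ 2).
  rewrite mulrAC ler_pdivlMr//; move: CS; rewrite exprMn; lra.
rewrite -mulrA; apply: le_trans (ler_wpM2l (sqr_ge0 K) AB).
rewrite -[A z]sqr_sqrtr// -exprMn ler_sqr ?nnegrE// ?mulr_ge0 ?sqrtr_ge0//.
rewrite -[z in `|z|](mulmxKV Pu) KP ?sqrtr_ge0// => i.
rewrite -ler_sqr ?nnegrE ?sqrtr_ge0// sqr_sqrtr// real_normK ?num_real//.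
have [ik|ki] := ltnP i k.
  have -> : i = widen_ord (leqnSn k) (Ordinal ik) by exact: val_inj.
  by rewrite /A (bigD1 (Ordinal ik))//= lerDl sumr_ge0// => ? _; exact: sqr_ge0.
have -> // : i = ord_max by apply/val_inj/eqP; rewrite /= eqn_leq ki -ltnS ltn_ord.
Qed.

Lemma exists_timelike : exists t, bform B t t < 0.
Proof.
case: hL => n1 [P Pu PBP]; case: n B n1 P Pu PBP => [//|k] G _ P Pu PBP.
exists (delta_mx 0 ord_max *m P).
rewrite /bform trmx_mul !mulmxA -2!(mulmxA (delta_mx 0 ord_max)) PBP.
rewrite trmx_delta -mulmxA -rowE mul_diag_mx; rewrite !mxE /= ltnn addn1 ltnSn !eqxx /=.
by rewrite mulr1 ltrN10.
Qed.

Context (Bsym : B^T = B).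
Local Notation bformE := (bformE Bsym).

(** Subtract from x the multiple of y that makes it orthogonal to a timelike
    vector: the difference is still isotropic, hence zero by coercivity. *)
Lemma orthogonal_isotropic x y : y != 0 -> bform B x x = 0 -> bform B y y = 0 ->
  bform B x y = 0 -> exists a, x = a *: y.
Proof.
move=> y0 xx yy xy; have [t tt] := exists_timelike.
have [C C0 CP] := orthogonal_timelike_coercive tt.
have null z : bform B z t = 0 -> bform B z z = 0 -> z = 0.
  move=> zt zz; have := CP z zt; rewrite zz mulr0 => z2.
  by apply/eqP; rewrite -normr_eq0 -sqrf_eq0 eq_le z2 sqr_ge0.
have yt : bform B y t != 0 by apply: contraNneq y0 => yt; rewrite (null y).
exists (bform B x t / bform B y t); apply/eqP; rewrite -subr_eq0; apply/eqP/null.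
  by rewrite !bformE divfK// subrr.
by rewrite !bformE xx yy (bformC Bsym y x) xy; ring.
Qed.

End Lorentz.

(** * Eigendirections are limit roots *)

Section Eigendirections.
Context (R : realType) (n : nat) (m : 'I_n -> 'I_n -> option nat)
  (c : 'I_n -> 'I_n -> R) (W : groupType) (s : 'I_n -> W)
  (act : W -> 'rV[R]_n -> 'rV[R]_n).
Context (hWS : coxeter_system m s) (hc : coxeter_weights m c)
  (hact : geometric_action (coxeter_gram m c) s act)
  (hL : lorentzian (coxeter_gram m c)).

Local Notation B := (coxeter_gram m c).
Local Notation alpha := (simple_root R).
Let Bs : B^T = B := system_gram_sym hWS hc.
Local Notation bformE := (bformE Bs).

Lemma act_matrix w : exists M, forall x, act w x = x *m M.
Proof.
elim/(gen_ind hWS): w => [|i w [M wM]]; first by exists 1%:M => x; rewrite (act1 hact) mulmx1.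
exists (M *m (1%:M - 2 *: (B *m (alpha i)^T *m alpha i))) => x.
rewrite (actM hact) (act_gen hWS hact) wM mulmxA mulmxBr mulmx1; congr (_ - _).
rewrite -scalemxAr !mulmxA -scalerA; congr (_ *: _).
by rewrite [_ *m _^T]mx11_scalar mul_scalar_mx.
Qed.

(** The operator w - l is not invertible, so some nonzero linear form, written
    as the pairing with a vector y, vanishes on its image; the invariance of
    the form turns this into w y = l^-1 y. *)
Lemma inverse_eigenvector w x (l : R) : x != 0 -> act w x = l *: x -> l != 0 ->
  exists2 y, y != 0 & act w y = l^-1 *: y.
Proof.
move=> x0 wx l0; have Bu := lorentzian_unitmx hL; have [M wM] := act_matrix w.
have /eqP : \det (M - l%:M)^T = 0.
  rewrite det_tr; apply/eqP/det0P; exists x => //.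
  by rewrite mulmxBr -wM wx mul_mx_scalar subrr.
move=> /det0P[u u0 uM]; pose y := u *m invmx B.
have yB : B *m y^T = u^T.
  by apply: trmx_inj; rewrite trmx_mul !trmxK Bs /y mulmxKV.
have wy v : bform B (act w v) y = l * bform B v y.
  apply/eqP; rewrite -bformZl -subr_eq0 -bformNl -bformDl wM; apply/eqP.
  rewrite -mul_mx_scalar -mulmxBr /bform -mulmxA yB -mulmxA.
  by rewrite -[(M - _) *m u^T]trmxK trmx_mul trmxK uM trmx0 mulmx0 mxE.
exists y.
  by apply: contraNneq u0 => y0; rewrite -[u]trmxK -yB y0 trmx0 mulmx0 trmx0.
apply: (scalerI l0); rewrite scalerA divff// scale1r.
apply/eqP; rewrite -subr_eq0; apply: contraT => /(bform_nondeg Bu)[i].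
rewrite -(actVK hact w (alpha i)) !bformE wy (act_bform hWS hc hact).
by rewrite subrr eqxx.
Qed.

Lemma expr_gt1_inj (l : R) : 1 < `|l| -> injective (fun k => l ^+ k).
Proof.
move=> l1 j k /(congr1 Num.norm); rewrite !normrX.
by apply: ieexprIn; rewrite ?gt_eqF// (lt_trans _ l1).
Qed.

(** Power iteration.  Let y be an eigenvector for l^-1; x and y are isotropic
    and not orthogonal.  Split a simple root not orthogonal to y into its
    components p x, q y and z orthogonal to both.  On the last one w acts with
    bounded orbits, the form being definite there, and on y it contracts, so
    w^k alpha_i rescaled by (p l^k)^-1 tends to x. *)
Lemma eigendirection_limit w (x : nzvec R n) (l : R) :
  act w (nzvec_val x) = l *: nzvec_val x -> 1 < `|l| -> limit_roots act (line x).
Proof.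
move=> wx l1; have x0 := nzvec_neq0 x.
have Bu := lorentzian_unitmx hL.
have l0 : l != 0 by rewrite -normr_gt0 (lt_trans _ l1).
have [y y0 wy] := inverse_eigenvector x0 wx l0.
have l2 : l ^+ 2 != 1.
  by rewrite sqrf_eq1; apply/negP => /orP[]/eqP ll; move: l1; rewrite ll ?normrN normr1 ltxx.
have xx : bform B (nzvec_val x) (nzvec_val x) = 0.
  apply/eqP; have := act_bform hWS hc hact w (nzvec_val x) (nzvec_val x).
  rewrite wx !bformE mulrA -expr2 => /eqP; rewrite -subr_eq0 -[X in _ - X]mul1r -mulrBl.
  by rewrite mulf_eq0 subr_eq0 (negbTE l2).
have yy : bform B y y = 0.
  apply/eqP; have := act_bform hWS hc hact w y y.
  rewrite wy !bformE mulrA -expr2 => /eqP; rewrite -subr_eq0 -[X in _ - X]mul1r -mulrBl.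
  by rewrite mulf_eq0 subr_eq0 exprVn invr_eq1 (negbTE l2).
have xy : bform B (nzvec_val x) y != 0.
  apply: contraNneq l2 => xy; have [a xa] := orthogonal_isotropic hL Bs y0 xx yy xy.
  have : (l - l^-1) *: nzvec_val x = 0.
    by rewrite scalerBl -wx {1}xa (actZ hWS hact) wy [in X in _ - X]xa !scalerA mulrC subrr.
  move=> /eqP; rewrite scaler_eq0 (negbTE x0) orbF subr_eq0 => /eqP ll.
  by rewrite expr2 {2}ll divff.
have [i iy] := bform_nondeg Bu y0.
have actl k : act (w ^+ k)%g (nzvec_val x) = l ^+ k *: nzvec_val x by exact: (act_eigen_exp hWS hact).
have acty k : act (w ^+ k)%g y = l^-1 ^+ k *: y by exact: (act_eigen_exp hWS hact).
pose p := bform B (alpha i) y / bform B (nzvec_val x) y.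
pose q := bform B (alpha i) (nzvec_val x) / bform B (nzvec_val x) y.
pose z := alpha i - (p *: nzvec_val x + q *: y).
have p0 : p != 0 by rewrite mulf_neq0// invr_eq0.
have alphaE : alpha i = p *: nzvec_val x + q *: y + z by rewrite /z addrC subrK.
have zx : bform B z (nzvec_val x) = 0.
  by rewrite !bformE xx (bformC Bs y) mulr0 add0r divfK// subrr.
have zy : bform B z y = 0 by rewrite !bformE yy mulr0 addr0 divfK// subrr.
clearbody z.
(* The sign of r makes t timelike, so the orthogonal of x and y is coercive. *)
pose r := - (bform B (nzvec_val x) y)^-1.
pose t := nzvec_val x + r *: y.
have tt : bform B t t < 0.
  rewrite !bformE xx yy (bformC Bs y) /r mulNr mulVf//; lra.
have [C C0 CP] := orthogonal_timelike_coercive hL tt.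
have zk k : `|act (w ^+ k)%g z| ^+ 2 <= C * bform B z z.
  rewrite -[in leRHS](act_bform hWS hc hact (w ^+ k)%g); apply: CP; rewrite /t !bformE.
  have zkx : bform B (act (w ^+ k)%g z) (nzvec_val x) = 0.
    apply: (mulfI (expf_neq0 k l0)).
    by rewrite -(bformZr Bs) -actl (act_bform hWS hc hact) zx mulr0.
  have zky : bform B (act (w ^+ k)%g z) y = 0.
    apply: (mulfI (expf_neq0 k (invr_neq0 l0))).
    by rewrite -(bformZr Bs) -acty (act_bform hWS hc hact) zy mulr0.
  by rewrite zkx zky mulr0 addr0.
pose D := Num.sqrt (C * bform B z z).
have zD k : `|act (w ^+ k)%g z| <= D.
  rewrite -ler_sqr ?nnegrE ?sqrtr_ge0// sqr_sqrtr//.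
  exact: le_trans (sqr_ge0 _) (zk 0%N).
have gam_root k : coxeter_roots act (act (w ^+ k)%g (alpha i)) by exists (w ^+ k)%g, i.
have gam0 k : act (w ^+ k)%g (alpha i) != 0.
  apply/eqP => g0; have := root_norm hWS hc hact (gam_root k).
  by rewrite g0 -(scale0r 0) !bformE mul0r => /esym/eqP; rewrite oner_eq0.
exists (fun k => to_nzvec (gam0 k)); split.
- move=> j k /(congr1 (@nzvec_val R n)); rewrite !to_nzvecK => /(congr1 (fun v => bform B v y)).
  have gy h : bform B (act (w ^+ h)%g (alpha i)) y = l ^+ h * bform B (alpha i) y.
    apply: (mulfI (expf_neq0 h (invr_neq0 l0))).
    rewrite -[LHS](bformZr Bs) -acty (act_bform hWS hc hact) mulrA -exprMn mulVf//.
    by rewrite expr1n mul1r.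
  by rewrite !gy => /(mulIf iy)/(expr_gt1_inj l1).
- by move=> k; rewrite to_nzvecK.
apply/cvg_lineP => e e0.
have E0 : 0 < `|p|^-1 * (`|q| * `|y| + D) + 1.
  by rewrite ltr_wpDl// mulr_ge0 ?invr_ge0// addr_ge0 ?mulr_ge0// sqrtr_ge0.
have /cvgrPdist_lt/(_ _ (divr_gt0 e0 E0))[N _ Nl] : (fun k => `|l|^-1 ^+ k) @ \oo --> (0 : R).
  by apply: cvg_expr; rewrite ger0_norm ?invr_ge0// invf_lt1// (lt_trans _ l1).
exists N => k Nk; exists (p * l ^+ k)^-1; first by rewrite invr_eq0 mulf_neq0// expf_neq0.
rewrite to_nzvecK alphaE !(actD hWS hact) !(actZ hWS hact) actl acty.
have -> : (p * l ^+ k)^-1 *: (p *: (l ^+ k *: nzvec_val x) + q *: (l^-1 ^+ k *: y) +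
    act (w ^+ k)%g z) - nzvec_val x =
    (p * l ^+ k)^-1 *: (q *: (l^-1 ^+ k *: y) + act (w ^+ k)%g z).
  rewrite -addrA [LHS]addrC scalerDr (scalerA p) (scalerA (p * l ^+ k)^-1 (p * _)) mulVf.
    by rewrite scale1r addKr.
  by rewrite mulf_neq0// expf_neq0.
have := Nl k Nk; rewrite /= sub0r normrN ger0_norm ?exprn_ge0 ?invr_ge0// => lk.
rewrite !normrZ invfM normrM !normfV !normrX.
set L := `|l|^-1 ^+ k in lk *; have L0 : 0 <= L by rewrite exprn_ge0 ?invr_ge0.
have L1 : L <= 1 by rewrite exprn_ile1// ?invr_ge0// invf_le1 ?(ltW l1)// (lt_trans _ l1).
have -> : (`|l| ^+ k)^-1 = L by rewrite /L exprVn.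
have nb : `|q *: (l^-1 ^+ k *: y) + act (w ^+ k)%g z| <= `|q| * `|y| + D.
  rewrite (le_trans (ler_normD _ _))// lerD// !normrZ ler_wpM2l// normrX normfV -/L.
  by rewrite ler_piMl.
apply: (@le_lt_trans _ _ (L * (`|p|^-1 * (`|q| * `|y| + D) + 1))).
  rewrite mulrAC mulrC ler_wpM2l// (@le_trans _ _ (`|p|^-1 * (`|q| * `|y| + D)))//.
    by rewrite ler_wpM2l ?invr_ge0.
  by rewrite lerDl.
by rewrite -ltr_pdivlMr.
Qed.

(** An eigenvalue smaller than 1 in absolute value is treated by passing to the
    inverse of w. *)
Lemma nonunimodular_sub_limit_roots :
  nonunimodular_directions act `<=` limit_roots act.
Proof.
move=> _ [w [x [l [_ wx l1 ->]]]]; have x0 := nzvec_neq0 x.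
have l0 : l != 0.
  apply: contraNneq x0 => l0; rewrite -(actK hact w (nzvec_val x)) wx l0 scale0r.
  by rewrite (act0 hWS hact).
have [ll|ll|//] := ltgtP `|l| 1; last exact: eigendirection_limit wx ll.
apply: (@eigendirection_limit w^-1%g x l^-1).
  apply: (scalerI l0); rewrite scalerA divff// scale1r.
  by rewrite -(actZ hWS hact) -wx (actK hact).
by rewrite normfV invf_gt1// normr_gt0.
Qed.

End Eigendirections.

(** * The set of limit roots is closed *)

Lemma injective_avoids (T : eqType) (u : nat -> T) (F : seq T) :
  injective u -> exists N, forall k, (N <= k)%N -> u k \notin F.
Proof.
move=> uinj; elim: F => [|a F [N NF]]; first by exists 0%N.
have [[j ja]|h] := pselect (exists j, u j = a).
  exists (maxn N j.+1) => k; rewrite geq_max => /andP[Nk jk].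
  rewrite in_cons negb_or NF// andbT -ja; apply/eqP => /uinj kj.
  by move: jk; rewrite kj ltnn.
exists N => k Nk; rewrite in_cons negb_or NF// andbT.
by apply/eqP => ka; apply: h; exists k.
Qed.

(** Choose the terms one after the other, avoiding the finite list of the
    previous ones. *)
Lemma injective_choice (T : eqType) (P : nat -> T -> Prop) :
  (forall k (F : seq T), exists2 x, x \notin F & P k x) ->
  exists2 u : nat -> T, injective u & forall k, P k (u k).
Proof.
move=> h; have /choice[f fP] : forall kF : nat * seq T, exists x, x \notin kF.2 /\ P kF.1 x.
  by move=> [k F]; have [x] := h k F; exists x.
pose hist := fix hist k := if k is k'.+1 then f (k', hist k') :: hist k' else [::].
pose u k := f (k, hist k).
have uh j k : (j < k)%N -> u j \in hist k.
  elim: k => // k IH; rewrite ltnS leq_eqVlt => /predU1P[->|/IH jk].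
    by rewrite /= mem_head.
  by rewrite /= in_cons jk orbT.
exists u => [j k ujk|k]; last by case: (fP (k, hist k)).
have [jk|kj|//] := ltngtP j k.
  by have := uh _ _ jk; rewrite ujk; case: (fP (k, hist k)) => /= /negP.
by have := uh _ _ kj; rewrite -ujk; case: (fP (j, hist j)) => /= /negP.
Qed.

(** Diagonal choice: within 1 / (k + 1) of a limit of limit roots there are
    infinitely many root directions, which leaves room for injectivity. *)
Lemma limit_roots_closed (R : realType) (n : nat) (W : groupType)
    (act : W -> 'rV[R]_n -> 'rV[R]_n) : closed (limit_roots act).
Proof.
move=> p; have [x ->] := line_surj p => /closure_lineP clx.
pose P k (g : nzvec R n) := coxeter_roots act (nzvec_val g) /\
  exists2 a : R, a != 0 & `|a *: nzvec_val g - nzvec_val x| < k.+1%:R^-1.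
have [|u uinj uP] := @injective_choice (nzvec R n) P.
  move=> k F; have e0 : 0 < k.+1%:R^-1 / 2 :> R by rewrite divr_gt0// invr_gt0.
  have [y [g [ginj groot /cvg_lineP gy]] yx] := clx _ e0.
  have [N gN] := gy _ e0; have [N' gN'] := injective_avoids F ginj.
  exists (g (maxn N N')); first by rewrite gN'// leq_maxr.
  split=> //; have [a a0 ay] := gN _ (leq_maxl N N').
  exists a => //; rewrite -[_ - _](subrKA (nzvec_val y)) (le_lt_trans (ler_normD _ _))//.
  by rewrite (splitr k.+1%:R^-1) ltrD.
exists u; split=> //; first by move=> k; case: (uP k).
apply/cvg_lineP => e e0.
have [N _ Ne] := near_infty_natSinv_lt (PosNum e0).
exists N => k Nk; have [_ [a a0 ax]] := uP k.
by exists a => //; exact: lt_trans ax (Ne k Nk).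
Qed.

Theorem theorem1p1 (R : realType) (n : nat) (m : 'I_n -> 'I_n -> option nat)
    (c : 'I_n -> 'I_n -> R) (W : groupType) (s : 'I_n -> W)
    (act : W -> 'rV[R]_n -> 'rV[R]_n)
    (hWS : coxeter_system m s)
    (hc : coxeter_weights m c)
    (hact : geometric_action (coxeter_gram m c) s act)
    (hL : lorentzian (coxeter_gram m c)) :
  limit_roots act = closure (nonunimodular_directions act).
Proof.
apply/seteqP; split.
  exact: limit_roots_sub_closure hWS hc hact (lorentzian_unitmx hL).
rewrite [X in _ `<=` X](closure_id _).1; last exact: limit_roots_closed.
apply: closure_subset; exact: (nonunimodular_sub_limit_roots hWS hc hact hL).
Qed.
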